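(* Let $\mathcal S$ be the system of partial differential equations $$u_t+uu_x+v_x=0,\qquad v_t+uv_x+u_x=0,\qquad w_t+uw_x=0$$ for unknown functions $u,v,w$ of $(t,x)$. The maximal Lie invariance algebra $\mathfrak g$ of $\mathcal S$ is infinite-dimensional and is spanned by the vector fields $$\mathcal D=t\partial_t+x\partial_x,\quad \mathcal G=t\partial_x+\partial_u,\quad \mathcal P^t=\partial_t,\quad \mathcal P^x=\partial_x,\quad \mathcal P^v=\partial_v,\quad \mathcal W(\Omega)=\Omega(w)\partial_w,$$ where $\Omega$ runs through the set of smooth functions of $w$.
   Context: The maximal Lie invariance algebra of a first-order system of PDEs is the Lie algebra of all vector fields $Q=\tau\partial_t+\xi\partial_x+\eta\partial_u+\theta\partial_v+\zeta\partial_w$, with coefficients smooth functions of $(t,x,u,v,w)$, whose first prolongation $Q^{(1)}$ to the first-order jet space satisfies the infinitesimal invariance criterion: $Q^{(1)}$ applied to the left-hand side of each equation of the system vanishes on the submanifold of the jet space defined by the system. ''Spanned'' means that every element of the algebra is a linear combination, with constant coefficients, of the listed vector fields. *)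

(* Defs.v *)
From HB Require Import structures.
From mathcomp Require Import all_boot all_order all_algebra.
From mathcomp Require Import all_classical all_reals all_analysis.

Set Implicit Arguments.
Unset Strict Implicit.
Unset Printing Implicit Defensive.

Import Order.TTheory GRing.Theory Num.Theory.
Import numFieldNormedType.Exports.

Local Open Scope classical_set_scope.
Local Open Scope ring_scope.

Section LinearAlgebra.
Variables (R : realType) (V : lmodType R).

Definition lin_span (S : set V) : set V :=
  [set v | exists (n : nat) (c : 'I_n -> R) (b : 'I_n -> V),
    (forall i, S (b i)) /\ v = \sum_(i < n) c i *: b i].

Definition infinite_dimensional (A : set V) : Prop :=
  ~ exists (n : nat) (b : 'I_n -> V), A `<=` lin_span (range b).

End LinearAlgebra.

(* All iterated directional derivatives exist and are (Frechet)
   differentiable; for finite-dimensional V this is C^oo. *)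
Definition smooth (R : realType) (V W : normedModType R) (f : V -> W) : Prop :=
  forall (s : seq V) (z : V), differentiable (foldr (fun v g => 'D_v g) f s) z.

Section Prolongation.
Variables (R : realType) (p q : nat).

(* jet0 is the space of the variables: independent x_i (i < p), then dependent variables u^a (a < q). *)
Definition jet0 : normedModType R := ('rV[R]_p * 'rV[R]_q)%type.

(* In (z, m) : jet1 the entry m a i is the jet coordinate u^a_i, standing for
   the derivative of u^a with respect to x_i. *)
Definition jet1 : normedModType R := (jet0 * 'M[R]_(q, p))%type.

(* The map Q stands for the vector field
   \sum_i (Q z).1 0 i d/dx_i + \sum_a (Q z).2 0 a d/du^a. *)
Definition vector_field := jet0 -> jet0.

Definition partial_x (i : 'I_p) (g : jet0 -> R) (z : jet0) : R :=
  'D_((delta_mx 0 i, 0) : jet0) g z.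

Definition partial_u (a : 'I_q) (g : jet0 -> R) (z : jet0) : R :=
  'D_((0, delta_mx 0 a) : jet0) g z.

Definition total_derivative (i : 'I_p) (g : jet0 -> R) (j : jet1) : R :=
  partial_x i g j.1 + \sum_(a < q) j.2 a i * partial_u a g j.1.

Definition prolongation (Q : vector_field) (j : jet1) : jet1 :=
  (Q j.1,
   \matrix_(a < q, i < p)
     (total_derivative i (fun z => (Q z).2 0 a) j
      - \sum_(k < p) total_derivative i (fun z => (Q z).1 0 k) j * j.2 a k)).

Definition smooth_vector_field (Q : vector_field) : Prop :=
  (forall i, smooth (fun z => (Q z).1 0 i)) /\
  (forall a, smooth (fun z => (Q z).2 0 a)).

(* F k is the left-hand side of the k-th equation F k = 0. *)
Definition max_Lie_invariance_algebra (l : nat) (F : 'I_l -> jet1 -> R) :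
    set vector_field :=
  [set Q | smooth_vector_field Q /\
    forall j : jet1, (forall k, F k j = 0) ->
      forall k, 'D_(prolongation Q j) (F k) j = 0].

End Prolongation.

Section System.
Variable R : realType.

(* x_0 = t, x_1 = x; u^0 = u, u^1 = v, u^2 = w.
   Indices are taken in the rings of integers mod 2 and mod 3: 2%:R is index 2. *)
Definition system_S (k : 'I_3) (j : jet1 R 2 3) : R :=
  let u   := j.1.2 0 0 in
  let u_t := j.2 0 0 in
  let u_x := j.2 0 1 in
  let v_t := j.2 1 0 in
  let v_x := j.2 1 1 in
  let w_t := j.2 2%:R 0 in
  let w_x := j.2 2%:R 1 in
  [:: u_t + u * u_x + v_x;
      v_t + u * v_x + u_x;
      w_t + u * w_x]`_k.

Definition mk_field (tau xi eta theta zeta : jet0 R 2 3 -> R) :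
    vector_field R 2 3 :=
  fun z => (\row_i [:: tau z; xi z]`_i, \row_a [:: eta z; theta z; zeta z]`_a).

Definition coord_t (z : jet0 R 2 3) : R := z.1 0 0.
Definition coord_x (z : jet0 R 2 3) : R := z.1 0 1.
Definition coord_w (z : jet0 R 2 3) : R := z.2 0 2%:R.

Definition field_D  := mk_field coord_t coord_x 0 0 0.
Definition field_G  := mk_field 0 coord_t 1 0 0.
Definition field_Pt := mk_field 1 0 0 0 0.
Definition field_Px := mk_field 0 1 0 0 0.
Definition field_Pv := mk_field 0 0 0 1 0.
Definition field_W (Omega : R -> R) := mk_field 0 0 0 0 (Omega \o coord_w).

Definition generators : set (vector_field R 2 3) :=
  [set field_D; field_G; field_Pt; field_Px; field_Pv] `|`
  [set field_W Omega | Omega in [set Omega : R -> R | smooth Omega]].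

End System.

(* Main.v *)
(* Restricting the infinitesimal invariance criterion to the solution manifold
   of the system, on which u_x, v_x, w_x are free, and splitting it as a
   quadratic polynomial in them yields the determining equations; they force tau
   to depend on t alone, xi on t and x, and zeta not to depend on u and v.
   No second derivative is needed to integrate them: a relation f + u g = 0
   between functions that do not depend on u gives f = g = 0, which kills the
   derivatives of eta, theta and zeta except zeta_w, while xi_t = eta constant
   makes xi_x = tau_t constant. Conversely every field of the resulting form
   solves the determining equations. For infinite dimension, if n fields spanned
   the algebra, evaluating W(w^k), k <= n, at w = 0, ..., n would factor an
   invertible Vandermonde matrix of size n + 1 through R^n. *)
Require Import Defs.
From HB Require Import structures.
From mathcomp Require Import all_boot all_order all_algebra.
From mathcomp Require Import all_classical all_reals all_analysis.
From mathcomp Require Import ring lra.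

Set Implicit Arguments.
Unset Strict Implicit.
Unset Printing Implicit Defensive.

Import Order.TTheory GRing.Theory Num.Theory.
Import numFieldNormedType.Exports.

Local Open Scope classical_set_scope.
Local Open Scope ring_scope.

(** * Directional derivatives compared through their difference quotients *)

Section DifferenceQuotients.
Variables (R : realType) (V V' W : normedModType R).
Variables (f : V -> W) (v z : V) (g : V' -> W) (v' z' : V').
Hypothesis fg : forall h : R, f (h *: v + z) - f z = g (h *: v' + z') - g z'.

Let quotient_eq : (fun h : R => h^-1 *: ((f \o shift z) (h *: v) - f z)) =
  (fun h : R => h^-1 *: ((g \o shift z') (h *: v') - g z')).
Proof. by apply/funext => h; rewrite /= fg. Qed.

(** A directional derivative depends only on increments along one line, so maps on different spaces
    and at different points can be compared. *)
Lemma derivable_congr : derivable g z' v' -> derivable f z v.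
Proof. by rewrite /derivable quotient_eq. Qed.

Lemma derive_congr : 'D_v f z = 'D_v' g z'.
Proof. by rewrite /derive quotient_eq. Qed.

End DifferenceQuotients.

Section DirectionalDerivatives.
Variables (R : realType) (V W : normedModType R).
Implicit Types (f : V -> W) (g : V -> R) (v w z : V).

Lemma is_derive_quotient f v z (d : W) :
  (forall h : R, f (h *: v + z) = f z + h *: d) -> is_derive z v f d.
Proof.
move=> fE.
have H : (fun h : R => h^-1 *: ((f \o shift z) (h *: v) - f z)) @ 0^' --> d.
  apply: (@cvg_near_cst _ _ d _ 0^').
  near=> h; rewrite /= fE addrAC subrr add0r scalerA mulVf ?scale1r//.
  by near: h; exact: nbhs_dnbhs_neq.
by apply: DeriveDef; [apply: cvgP H|apply: cvg_lim H].
Unshelve. all: by end_near. Qed.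

Lemma is_derive_linear (l : V -> W) v z : linear l -> is_derive z v l (l v).
Proof. by move=> ll; apply: is_derive_quotient => h; rewrite ll addrC. Qed.

Lemma derive_shiftD f w v z (k : W) :
  (forall z', f (z' + w) = f z' + k) -> 'D_v f (z + w) = 'D_v f z.
Proof.
move=> fw; apply: derive_congr => h.
by rewrite addrA !fw opprD addrACA subrr addr0.
Qed.

(** On the line through [z] in direction [v], subtracting the slope leaves a real function with zero
    derivative, hence a constant. *)
Lemma shift_of_derive_cst g v (d : R) :
  (forall z, differentiable g z) -> (forall z, 'D_v g z = d) ->
  forall h z, g (z + h *: v) = g z + h * d.
Proof.
move=> dg gd h z.
pose p (s : R) := g (z + s *: v) - s * d.
have p' (s : R) : is_derive s (1 : R) p 0.
  have gs : is_derive s (1 : R) (fun s : R => g (z + s *: v)) d.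
    have gE (h0 : R) : g (z + (h0 *: 1 + s) *: v) - g (z + s *: v) =
        g (h0 *: v + (z + s *: v)) - g (z + s *: v).
      by rewrite [h0 *: 1]mulr1 scalerDl addrCA.
    apply: DeriveDef; last by rewrite (derive_congr gE).
    by apply: (derivable_congr gE); exact: diff_derivable.
  have -> : p = (fun s : R => g (z + s *: v)) - (d *: id).
    by apply/funext => x; rewrite /p !fctE mulrC.
  by apply: is_derive_eq; rewrite [d *: 1]mulr1 subrr.
have := is_derive_0_is_cst h 0 p'.
by rewrite /p mul0r subr0 scale0r addr0 => <-; rewrite subrK.
Qed.

Lemma derive_eq0_of_shift f v z :
  (forall h, f (z + h *: v) = f z) -> 'D_v f z = 0.
Proof.
move=> fv; have fd : is_derive z v f 0.
  by apply: is_derive_quotient => h; rewrite addrC fv scaler0 addr0.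
by rewrite derive_val.
Qed.

End DirectionalDerivatives.

(** * Closure properties of smooth maps *)

Section Smooth.
Variable R : realType.
Implicit Types V W U : normedModType R.

Lemma smooth_differentiable V W (f : V -> W) :
  smooth f -> forall z, differentiable f z.
Proof. by move=> fS z; exact: (fS [::] z). Qed.

Lemma smooth_derive V W (f : V -> W) v : smooth f -> smooth ('D_v f).
Proof. by move=> fS s z; have := fS (rcons s v) z; rewrite foldr_rcons. Qed.

(** A coinduction principle: a class of differentiable maps stable under directional derivatives
    contains all iterated derivatives of its members. The last direction of a list is differentiated
    first, hence the induction from the right. *)
Lemma smooth_coind V W (C : set (V -> W)) :
  (forall f, C f -> forall z, differentiable f z) ->
  (forall f, C f -> forall v, C ('D_v f)) ->
  forall f, C f -> smooth f.
Proof.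
move=> dC DC f + s; elim/last_ind: s f => [|s v ih] f Cf z; first exact: dC.
by rewrite foldr_rcons; apply: ih; exact: DC.
Qed.

Lemma smooth_comp_linear U V W (f : V -> W) (l : U -> V) :
  linear l -> continuous l -> smooth f -> smooth (f \o l).
Proof.
move=> ll lc fS.
pose L : {linear U -> V} := HB.pack l (GRing.isLinear.Build _ _ _ _ l ll).
apply: (smooth_coind (C := [set f \o l | f in @smooth R V W])) => [||]; last by exists f.
- move=> _ [g gS <-] z; apply: differentiable_comp.
    exact: (@linear_differentiable _ _ _ L).
  exact: smooth_differentiable.
(* By linearity, the increments of [g \o l] along [v] are those of [g] along [l v]. *)
- move=> _ [g gS <-] v; exists ('D_(l v) g); first exact: smooth_derive.
  by apply/funext => z; apply: derive_congr => h /=; rewrite ll.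
Qed.

Lemma smoothD V W (f g : V -> W) : smooth f -> smooth g -> smooth (f + g).
Proof.
move=> fS gS.
pose C := [set h : V -> W | exists f g, [/\ smooth f, smooth g & h = f + g]].
apply: (smooth_coind (C := C)); last by exists f, g.
- move=> _ [{}f [{}g [{}fS {}gS ->]]] z.
  by apply: differentiableD; exact: smooth_differentiable.
- move=> _ [{}f [{}g [{}fS {}gS ->]]] v.
  exists ('D_v f), ('D_v g); split; [exact: smooth_derive..|].
  by apply/funext => z; rewrite deriveD//; apply: diff_derivable; exact: smooth_differentiable.
Qed.

Lemma smoothZ V W (c : R) (f : V -> W) : smooth f -> smooth (c *: f).
Proof.
move=> fS.
apply: (smooth_coind (C := [set c *: f | f in @smooth R V W])); last by exists f.
- by move=> _ [{}f {}fS <-] z; apply: differentiableZ; exact: smooth_differentiable.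
- move=> _ [{}f {}fS <-] v; exists ('D_v f); first exact: smooth_derive.
  by apply/funext => z; rewrite deriveZ//; apply: diff_derivable; exact: smooth_differentiable.
Qed.

Lemma smooth_cst V W (c : W) : smooth (cst c : V -> W).
Proof.
apply: (smooth_coind (C := range cst)); last by exists c.
- by move=> _ [{}c _ <-] z; exact: differentiable_cst.
- by move=> _ [{}c _ <-] v; exists 0 => //; apply/funext => z; rewrite derive_cst.
Qed.

(** Polynomial functions are stable under differentiation: the derivative in direction [v] is [v]
    times the formal one. *)
Lemma smooth_horner (p : {poly R}) : smooth (horner p : R -> R).
Proof.
apply: (smooth_coind (C := range (fun p : {poly R} => horner p))); last by exists p.
- by move=> _ [{}p _ <-] z; apply/derivable1_diffP/derivable_horner.
- move=> _ [{}p _ <-] v; exists (v *: p^`()) => //; apply/funext => z.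
  have dp : differentiable (horner p) z by apply/derivable1_diffP/derivable_horner.
  rewrite deriveE// -[v in RHS]mulr1 linearZ /= -deriveE// -derive1E -derivE.
  by rewrite hornerZ.
Qed.

Lemma smooth_linear V (l : V -> R) : linear l -> continuous l -> smooth l.
Proof.
(* A linear form is the identity polynomial composed with a continuous linear map. *)
move=> ll lc; have := smooth_comp_linear ll lc (smooth_horner 'X).
by congr smooth; apply/funext => z /=; rewrite hornerX.
Qed.

End Smooth.

(** * Cases and sums over the indices of the two independent and three dependent variables *)

Lemma ord2_ind (P : 'I_2 -> Prop) : P 0 -> P 1 -> forall i, P i.
Proof.
by move=> P0 P1 [[|[|//]] lti];
  [rewrite (_ : Ordinal _ = 0)|rewrite (_ : Ordinal _ = 1)]; rewrite //; apply/val_inj.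
Qed.

Lemma ord3_ind (P : 'I_3 -> Prop) : P 0 -> P 1 -> P 2%:R -> forall i, P i.
Proof.
by move=> P0 P1 P2 [[|[|[|//]]] lti];
  [rewrite (_ : Ordinal _ = 0)|rewrite (_ : Ordinal _ = 1)
  |rewrite (_ : Ordinal _ = 2%:R)]; rewrite //; apply/val_inj.
Qed.

Lemma sum_ord2 (V : nmodType) (F : 'I_2 -> V) : \sum_(i < 2) F i = F 0 + F 1.
Proof.
by rewrite !big_ord_recl big_ord0 addr0; congr (F _ + F _); apply/val_inj.
Qed.

Lemma sum_ord3 (V : nmodType) (F : 'I_3 -> V) :
  \sum_(i < 3) F i = F 0 + F 1 + F 2%:R.
Proof.
rewrite !big_ord_recl big_ord0 addr0 addrA.
by congr (F _ + F _ + F _); apply/val_inj.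
Qed.

(** * The invariance criterion and the determining equations *)

Section System.
Variable R : realType.
Local Notation J0 := (jet0 R 2 3).
Local Notation J1 := (jet1 R 2 3).

Definition jet_u (a : 'I_3) (j : J1) : R := j.1.2 0 a.
Definition jet_p (a : 'I_3) (i : 'I_2) (j : J1) : R := j.2 a i.

Lemma is_derive_jet_u a (j V : J1) : is_derive j V (jet_u a) (jet_u a V).
Proof. by apply: is_derive_linear => c x y; rewrite /jet_u /= !mxE. Qed.

Lemma is_derive_jet_p a i (j V : J1) : is_derive j V (jet_p a i) (jet_p a i V).
Proof. by apply: is_derive_linear => c x y; rewrite /jet_p /= !mxE. Qed.

Lemma derive_system_S (j V : J1) :
  [/\ 'D_V (system_S 0) j =
        V.2 0 0 + (j.1.2 0 0 * V.2 0 1 + j.2 0 1 * V.1.2 0 0) + V.2 1 1,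
      'D_V (system_S 1) j =
        V.2 1 0 + (j.1.2 0 0 * V.2 1 1 + j.2 1 1 * V.1.2 0 0) + V.2 0 1 &
      'D_V (system_S 2%:R) j =
        V.2 2%:R 0 + (j.1.2 0 0 * V.2 2%:R 1 + j.2 2%:R 1 * V.1.2 0 0)].
Proof.
have pP := is_derive_jet_p; have uP := is_derive_jet_u.
split.
- exact: (@derive_val _ _ _ _ _ _ _ (is_deriveD
    (is_deriveD (pP 0 0 j V) (is_deriveM (uP 0 j V) (pP 0 1 j V))) (pP 1 1 j V))).
- exact: (@derive_val _ _ _ _ _ _ _ (is_deriveD
    (is_deriveD (pP 1 0 j V) (is_deriveM (uP 0 j V) (pP 1 1 j V))) (pP 0 1 j V))).
- exact: (@derive_val _ _ _ _ _ _ _ (is_deriveD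
    (pP 2%:R 0 j V) (is_deriveM (uP 0 j V) (pP 2%:R 1 j V)))).
Qed.

(** The values at 0 and at plus or minus each unit vector isolate the constant, linear and square
    coefficients; sums of two unit vectors then give the mixed ones. *)
Lemma quadratic_eq0 (k0 ka kb kc kaa kbb kcc kab kac kbc : R) :
  (forall a b c : R, k0 + ka * a + kb * b + kc * c + kaa * a ^+ 2 + kbb * b ^+ 2
     + kcc * c ^+ 2 + kab * (a * b) + kac * (a * c) + kbc * (b * c) = 0) ->
  [/\ k0 = 0, [/\ ka = 0, kb = 0 & kc = 0], [/\ kaa = 0, kbb = 0 & kcc = 0] &
      [/\ kab = 0, kac = 0 & kbc = 0]].
Proof.
move=> h.
have h0 := h 0 0 0.
have a1 := h 1 0 0; have a2 := h (-1) 0 0.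
have b1 := h 0 1 0; have b2 := h 0 (-1) 0.
have c1 := h 0 0 1; have c2 := h 0 0 (-1).
have ab := h 1 1 0; have ac := h 1 0 1; have bc := h 0 1 1.
by split; [|split..]; lra.
Qed.

(* A name gk is the k-th partial derivative at a point of the coefficient g,
   with g = t, x, e, h, z standing for tau, xi, eta, theta, zeta; a, b, c are
   u_x, v_x, w_x, and Pt, Px give the entries of the prolongation. *)
Lemma determining_algebra (u zw eta tt tx tu tv tw xt xx xu xv xw : R)
    (et ex eu ev ew ht hx hu hv hw zt zx zu zv : R) :
  (forall a b c : R,
    let ut := - (u * a + b) in let vt := - (u * b + a) in let wt := - (u * c) in
    let Dt gt gu gv gw := gt + (ut * gu + vt * gv + wt * gw) in
    let Dx gx gu gv gw := gx + (a * gu + b * gv + c * gw) in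
    let Pt gt gu gv gw mt mx :=
      Dt gt gu gv gw - (Dt tt tu tv tw * mt + Dt xt xu xv xw * mx) in
    let Px gx gu gv gw mt mx :=
      Dx gx gu gv gw - (Dx tx tu tv tw * mt + Dx xx xu xv xw * mx) in
    [/\ Pt et eu ev ew ut a + (u * Px ex eu ev ew ut a + a * eta)
          + Px hx hu hv hw vt b = 0,
        Pt ht hu hv hw vt b + (u * Px hx hu hv hw vt b + b * eta)
          + Px ex eu ev ew ut a = 0 &
        Pt zt zu zv zw wt c + (u * Px zx zu zv zw wt c + c * eta) = 0]) <->
  [/\ [/\ tx = 0, tu = 0, tv = 0 & tw = 0],
      [/\ xt = eta, xx = tt, xu = 0, xv = 0 & xw = 0],
      [/\ hu = ev, hv = eu, ew = 0 & hw = 0],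
      et + u * ex + hx = 0 /\ ht + u * hx + ex = 0 &
      [/\ zt + u * zx = 0, zu = 0 & zv = 0]].
Proof.
rewrite /=; split=> [h|].
(* [- N] is the coefficient of [w_x] in the third equation, where [zw] cancels; [N] recurs in the
   first two. Below, each equation is split into coefficients, and [0 = 0] fills the slot of a
   monomial with zero coefficient. *)
- pose N := xt + u * xx - u * tt - u ^+ 2 * tx - eta.
  have [e0 [ea eb ec] [eaa ebb _] [_ eac ebc]] : [/\ et + u * ex + hx = 0,
      [/\ - ev - N + hu + tx = 0, - eu + tt + u * tx + hv - (xx - u * tx) = 0 & hw = 0],
      [/\ xv - u * tv + tu = 0, - tu - (xv - u * tv) = 0 & (0 : R) = 0] &
      [/\ (0 : R) = 0, tw = 0 & - (xw - u * tw) = 0]].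
    by apply: quadratic_eq0 => a b c; have [h1 _ _] := h a b c; rewrite -[RHS]h1 /N; ring.
  have [h0 [ha hb hc] [haa hbb _] [_ hac hbc]] : [/\ ht + u * hx + ex = 0,
      [/\ - hv + tt + u * tx + eu - (xx - u * tx) = 0, - hu - N + ev + tx = 0 & ew = 0],
      [/\ - tv - (xu - u * tu) = 0, xu - u * tu + tv = 0 & (0 : R) = 0] &
      [/\ (0 : R) = 0, - (xw - u * tw) = 0 & tw = 0]].
    by apply: quadratic_eq0 => a b c; have [_ h1 _] := h a b c; rewrite -[RHS]h1 /N; ring.
  have [z0 [za zb zc] _ [_ zac zbc]] : [/\ zt + u * zx = 0,
      [/\ - zv = 0, - zu = 0 & - N = 0],
      [/\ (0 : R) = 0, (0 : R) = 0 & (0 : R) = 0] &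
      [/\ (0 : R) = 0, xv - u * tv = 0 & xu - u * tu = 0]].
    by apply: quadratic_eq0 => a b c; have [_ _ h1] := h a b c; rewrite -[RHS]h1 /N; ring.
  clear h.
  (* In [ea + hb] the terms [ev] and [hu] cancel, which leaves [tx = N], and [zc] says that [N]
     vanishes. Likewise [eaa] with [zac] gives [tu], [hbb] with [zbc] gives [tv], and [eb + ha]
     gives [xx]. *)
  have tx0 : tx = 0 by lra.
  have tu0 : tu = 0 by lra.
  have tv0 : tv = 0 by lra.
  have xx0 : xx = tt by rewrite tx0 in eb ha; lra.
  (* Known values are substituted into the products with [u], so that the remaining relations become
     linear. *)
  rewrite /N tx0 xx0 in zc; rewrite tu0 in zbc; rewrite tv0 in zac; rewrite eac in ebc.
  rewrite /N tx0 xx0 in ea; rewrite tx0 xx0 in eb.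
  by split; [split|split|split|split|split]; lra.
- move=> [[-> -> -> ->] [<- -> -> -> ->] [-> -> -> ->] [e0 h0] [z0 -> ->]] a b c.
  have -> : et = - (u * ex + hx) by lra.
  have -> : ht = - (u * hx + ex) by lra.
  have -> : zt = - (u * zx) by lra.
  by split; ring.
Qed.


Definition comp_x (Q : vector_field R 2 3) (i : 'I_2) (z : J0) : R := (Q z).1 0 i.
Definition comp_u (Q : vector_field R 2 3) (a : 'I_3) (z : J0) : R := (Q z).2 0 a.

Definition determining_equations (Q : vector_field R 2 3) (z : J0) : Prop :=
  let u := z.2 0 0 in
  let tau := comp_x Q 0 in let xi := comp_x Q 1 in
  let eta := comp_u Q 0 in let theta := comp_u Q 1 in
  let zeta := comp_u Q 2%:R in
  [/\ [/\ partial_x 1 tau z = 0, partial_u 0 tau z = 0,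
          partial_u 1 tau z = 0 & partial_u 2%:R tau z = 0],
      [/\ partial_x 0 xi z = eta z, partial_x 1 xi z = partial_x 0 tau z,
          partial_u 0 xi z = 0, partial_u 1 xi z = 0 & partial_u 2%:R xi z = 0],
      [/\ partial_u 0 theta z = partial_u 1 eta z,
          partial_u 1 theta z = partial_u 0 eta z,
          partial_u 2%:R eta z = 0 & partial_u 2%:R theta z = 0],
      partial_x 0 eta z + u * partial_x 1 eta z + partial_x 1 theta z = 0 /\
      partial_x 0 theta z + u * partial_x 1 theta z + partial_x 1 eta z = 0 &
      [/\ partial_x 0 zeta z + u * partial_x 1 zeta z = 0,
          partial_u 0 zeta z = 0 & partial_u 1 zeta z = 0]].

Lemma prolongation_entry (Q : vector_field R 2 3) (j : J1) a i :
  let D := fun g : J0 -> R => partial_x i g j.1 + (j.2 0 i * partial_u 0 g j.1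
    + j.2 1 i * partial_u 1 g j.1 + j.2 2%:R i * partial_u 2%:R g j.1) in
  (prolongation Q j).2 a i =
    D (comp_u Q a) - (D (comp_x Q 0) * j.2 a 0 + D (comp_x Q 1) * j.2 a 1).
Proof. by rewrite /= mxE sum_ord2 /total_derivative !sum_ord3. Qed.

(* Hence u_x, v_x, w_x parametrize the submanifold cut out by the system. *)
Lemma system_S_solved (j : J1) :
  (forall k, system_S k j = 0) <->
  [/\ j.2 0 0 = - (j.1.2 0 0 * j.2 0 1 + j.2 1 1),
      j.2 1 0 = - (j.1.2 0 0 * j.2 1 1 + j.2 0 1) &
      j.2 2%:R 0 = - (j.1.2 0 0 * j.2 2%:R 1)].
Proof.
split=> [jS | [j0 j1 j2]].
- by split; apply/eqP; rewrite -addr_eq0 ?addrA; apply/eqP;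
    [exact: (jS 0)|exact: (jS 1)|exact: (jS 2%:R)].
- by elim/ord3_ind; rewrite /system_S /= ?j0 ?j1 ?j2 ?opprD ?addrA ?addrNK ?addNr//;
    rewrite addrAC addrNK addNr.
Qed.

Lemma invariance_iff_determining_equations (Q : vector_field R 2 3) :
  (forall j : J1, (forall k, system_S k j = 0) ->
    forall k, 'D_(prolongation Q j) (system_S k) j = 0) <->
  (forall z, determining_equations Q z).
Proof.
split=> [inv z | det j /system_S_solved[j0 j1 j2]].
(* The derivative of zeta in [w] is absent from the determining equations, so it has to be supplied
   explicitly. *)
- apply/(determining_algebra (z.2 0 0) (partial_u 2%:R (comp_u Q 2%:R) z)) => a b c.
  pose u := z.2 0 0.
  (* The jet over [z] with [x]-derivatives [a], [b], [c], whose [t]-derivatives are solved from the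
     system. *)
  pose m : 'M[R]_(3, 2) := \matrix_(k, i) nth 0 (nth [::]
    [:: [:: - (u * a + b); a]; [:: - (u * b + a); b]; [:: - (u * c); c]] k) i.
  have mS k : system_S k (z, m) = 0.
    by apply/system_S_solved: k; split; rewrite /= !mxE.
  have {}inv k := inv _ mS k.
  have [S0 S1 S2] := derive_system_S (z, m) (prolongation Q (z, m)).
  have i0 := inv 0; have i1 := inv 1; have i2 := inv 2%:R.
  rewrite S0 !prolongation_entry /= !mxE /= in i0.
  rewrite S1 !prolongation_entry /= !mxE /= in i1.
  rewrite S2 !prolongation_entry /= !mxE /= in i2.
  by split.
- have [S0 S1 S2] := derive_system_S j (prolongation Q j).
  have [e0 e1 e2] := (determining_algebra _ (partial_u 2%:R (comp_u Q 2%:R) j.1)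
    _ _ _ _ _ _ _ _ _ _ _ _ _ _ _ _ _ _ _ _ _ _ _ _ _).2 (det j.1)
    (j.2 0 1) (j.2 1 1) (j.2 2%:R 1).
  by elim/ord3_ind; [rewrite S0|rewrite S1|rewrite S2]; rewrite !prolongation_entry j0 j1 j2.
Qed.

End System.

(** * Integration of the determining equations *)

Section Solution.
Variable R : realType.
Local Notation J0 := (jet0 R 2 3).

Definition basis_x (i : 'I_2) : J0 := (delta_mx 0 i, 0).
Definition basis_u (a : 'I_3) : J0 := (0, delta_mx 0 a).

(** The order of the summands lets shifts be stripped from the right, [t] first, until only the
    point on the [w]-axis is left. *)
Lemma jet0_decomposition (z : J0) :
  z = z.2 0 2%:R *: basis_u 2%:R + z.2 0 1 *: basis_u 1 + z.2 0 0 *: basis_u 0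
      + z.1 0 1 *: basis_x 1 + z.1 0 0 *: basis_x 0.
Proof.
case: z => zx zu; rewrite /basis_x /basis_u; congr pair; apply/rowP.
- by elim/ord2_ind; rewrite /= !mxE /= !(mulr0, mulr1, add0r, addr0).
- by elim/ord3_ind; rewrite /= !mxE /= !(mulr0, mulr1, add0r, addr0).
Qed.

Definition invariant_along (v : J0) (g : J0 -> R) :=
  forall (h : R) z, g (z + h *: v) = g z.

(** Differentiation commutes with translations; this replaces the symmetry of mixed second
    derivatives. *)
Lemma invariant_derive v w g : invariant_along v g -> invariant_along v ('D_w g).
Proof.
move=> gv h z; apply: (@derive_shiftD _ _ _ g (h *: v) w z 0) => z'.
by rewrite gv addr0.
Qed.

Lemma invariant_of_derive v g :
  smooth g -> (forall z, 'D_v g z = 0) -> invariant_along v g.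
Proof.
move=> gS gv h z.
by rewrite (shift_of_derive_cst (smooth_differentiable gS) gv) mulr0 addr0.
Qed.

Lemma invariant_along_eq v f g : f =1 g -> invariant_along v g -> invariant_along v f.
Proof. by move=> /funext ->. Qed.

(** Subtracting the relation at [z] from the one at [z] shifted by one unit of [u] leaves
    [g z = 0]. *)
Lemma affine_in_u_eq0 (f g : J0 -> R) :
  invariant_along (basis_u 0) f -> invariant_along (basis_u 0) g ->
  (forall z, f z + z.2 0 0 * g z = 0) -> forall z, f z = 0 /\ g z = 0.
Proof.
move=> fu gu fg z; have := fg (z + 1 *: basis_u 0).
rewrite fu gu /= !mxE /= !mulr1 mulrDl mul1r addrA fg add0r => g0.
by split=> //; have := fg z; rewrite g0 mulr0 addr0.
Qed.

Lemma affine_of_partials (g : J0 -> R) (ct cx cu cv : R) : smooth g ->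
  (forall z, partial_x 0 g z = ct) -> (forall z, partial_x 1 g z = cx) ->
  (forall z, partial_u 0 g z = cu) -> (forall z, partial_u 1 g z = cv) ->
  forall z, g z = g (z.2 0 2%:R *: basis_u 2%:R)
    + z.2 0 1 * cv + z.2 0 0 * cu + z.1 0 1 * cx + z.1 0 0 * ct.
Proof.
move=> /smooth_differentiable gd gt gx gu gv z.
rewrite {1}(jet0_decomposition z) (shift_of_derive_cst gd gt).
by rewrite (shift_of_derive_cst gd gx) (shift_of_derive_cst gd gu) (shift_of_derive_cst gd gv).
Qed.

Lemma invariant_cst (g : J0 -> R) :
  (forall i, invariant_along (basis_x i) g) ->
  (forall a, invariant_along (basis_u a) g) -> forall z, g z = g 0.
Proof.
move=> gx gu z; rewrite {1}(jet0_decomposition z) !gx !gu.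
by rewrite -[X in g X]add0r gu.
Qed.

(* The general element of the algebra: dilation d, boost g, translations q, p, h. *)
Definition canonical_field (d g q p h : R) (Omega : R -> R) : vector_field R 2 3 :=
  mk_field (fun z => d * coord_t z + q) (fun z => d * coord_x z + g * coord_t z + p)
    (cst g) (cst h) (Omega \o @coord_w R).

Lemma solve_determining_equations (Q : vector_field R 2 3) :
  smooth_vector_field Q -> (forall z, determining_equations Q z) ->
  exists d g q p h Omega, smooth Omega /\ Q = canonical_field d g q p h Omega.
Proof.
move=> [xS uS] det.
pose tau := comp_x Q 0; pose xi := comp_x Q 1.
pose eta := comp_u Q 0; pose theta := comp_u Q 1; pose zeta := comp_u Q 2%:R.
have tauS : smooth tau := xS 0.
have xiS : smooth xi := xS 1.
have etaS : smooth eta := uS 0.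
have thetaS : smooth theta := uS 1.
have zetaS : smooth zeta := uS 2%:R.
have tau_x z : partial_x 1 tau z = 0 by case: (det z) => -[e _ _ _] _ _ _ _; exact: e.
have tau_u z : partial_u 0 tau z = 0 by case: (det z) => -[_ e _ _] _ _ _ _; exact: e.
have tau_v z : partial_u 1 tau z = 0 by case: (det z) => -[_ _ e _] _ _ _ _; exact: e.
have tau_w z : partial_u 2%:R tau z = 0 by case: (det z) => -[_ _ _ e] _ _ _ _; exact: e.
have xi_t z : partial_x 0 xi z = eta z by case: (det z) => _ [e _ _ _ _] _ _ _; exact: e.
have xi_x z : partial_x 1 xi z = partial_x 0 tau z.
  by case: (det z) => _ [_ e _ _ _] _ _ _; exact: e.
have xi_u z : partial_u 0 xi z = 0 by case: (det z) => _ [_ _ e _ _] _ _ _; exact: e.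
have xi_v z : partial_u 1 xi z = 0 by case: (det z) => _ [_ _ _ e _] _ _ _; exact: e.
have xi_w z : partial_u 2%:R xi z = 0 by case: (det z) => _ [_ _ _ _ e] _ _ _; exact: e.
have zeta_u z : partial_u 0 zeta z = 0 by case: (det z) => _ _ _ _ [_ e _]; exact: e.
have zeta_v z : partial_u 1 zeta z = 0 by case: (det z) => _ _ _ _ [_ _ e]; exact: e.
have iS := invariant_of_derive; have iD := invariant_derive.
have xi_iu : invariant_along (basis_u 0) xi := iS _ _ xiS xi_u.
have xi_iv : invariant_along (basis_u 1) xi := iS _ _ xiS xi_v.
have zeta_iu : invariant_along (basis_u 0) zeta := iS _ _ zetaS zeta_u.
have zeta_tx : forall z, partial_x 0 zeta z = 0 /\ partial_x 1 zeta z = 0.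
  apply: (affine_in_u_eq0 (iD _ (basis_x 0) _ zeta_iu) (iD _ (basis_x 1) _ zeta_iu)) => z.
  by case: (det z) => _ _ _ _ [e _ _]; exact: e.
(* Eta is the [t]-derivative of xi, so it inherits invariance along [u] and [v] from xi. *)
have eta_u z : partial_u 0 eta z = 0.
  apply: derive_eq0_of_shift => h; rewrite -!xi_t.
  exact: (iD _ (basis_x 0) _ xi_iu).
have eta_v z : partial_u 1 eta z = 0.
  apply: derive_eq0_of_shift => h; rewrite -!xi_t.
  exact: (iD _ (basis_x 0) _ xi_iv).
have eta_w z : partial_u 2%:R eta z = 0 by case: (det z) => _ _ [_ _ e _] _ _; exact: e.
have theta_u z : partial_u 0 theta z = 0.
  by case: (det z) => _ _ [e _ _ _] _ _; rewrite -(eta_v z); exact: e.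
have theta_v z : partial_u 1 theta z = 0.
  by case: (det z) => _ _ [_ e _ _] _ _; rewrite -(eta_u z); exact: e.
have theta_w z : partial_u 2%:R theta z = 0 by case: (det z) => _ _ [_ _ _ e] _ _; exact: e.
have eta_iu : invariant_along (basis_u 0) eta := iS _ _ etaS eta_u.
have theta_iu : invariant_along (basis_u 0) theta := iS _ _ thetaS theta_u.
(* The relation splits in powers of [u]; the second half then removes the eta term from the
   companion relation for theta. *)
have eta_tx : forall z, partial_x 0 eta z + partial_x 1 theta z = 0 /\ partial_x 1 eta z = 0.
  apply: affine_in_u_eq0 (iD _ (basis_x 1) _ eta_iu) _ => [h z | z].
    congr (_ + _); first exact: (iD _ (basis_x 0) _ eta_iu).
    exact: (iD _ (basis_x 1) _ theta_iu).
  by rewrite addrAC; case: (det z) => _ _ _ [e _] _; exact: e.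
have theta_tx : forall z, partial_x 0 theta z = 0 /\ partial_x 1 theta z = 0.
  apply: (affine_in_u_eq0 (iD _ (basis_x 0) _ theta_iu) (iD _ (basis_x 1) _ theta_iu)) => z.
  by rewrite -[LHS]addr0 -[X in _ + X](eta_tx z).2; case: (det z) => _ _ _ [_ e] _; exact: e.
have eta_t z : partial_x 0 eta z = 0.
  by rewrite -(eta_tx z).1 (theta_tx z).2 addr0.
have w_indep g (w : R) : smooth g -> (forall z, partial_u 2%:R g z = 0) ->
    g (w *: basis_u 2%:R) = g 0.
  by move=> gS gw; rewrite -[_ *: _]add0r; exact: (iS _ _ gS gw).
have etaE z : eta z = eta 0.
  rewrite (affine_of_partials etaS eta_t (fun z => (eta_tx z).2) eta_u eta_v).
  by rewrite w_indep// !mulr0 !addr0.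
have thetaE z : theta z = theta 0.
  rewrite (affine_of_partials thetaS (fun z => (theta_tx z).1) (fun z => (theta_tx z).2)
    theta_u theta_v).
  by rewrite w_indep// !mulr0 !addr0.
have {}xi_t z : partial_x 0 xi z = eta 0 by rewrite xi_t etaE.
have tau_t : forall z, partial_x 0 tau z = partial_x 0 tau 0.
  apply: invariant_cst.
    elim/ord2_ind; last exact: (iD _ _ _ (iS _ _ tauS tau_x)).
    (* Along [t]: a shift changes xi by a constant, as [xi_t] is constant, so its [x]-derivative,
       which equals [tau_t], is unchanged. *)
    apply: invariant_along_eq (fun z => esym (xi_x z)) _ => h z.
    apply: derive_shiftD => z'.
    exact: (shift_of_derive_cst (smooth_differentiable xiS) xi_t).
  elim/ord3_ind; apply: iD.
  - exact: (iS _ _ tauS tau_u).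
  - exact: (iS _ _ tauS tau_v).
  - exact: (iS _ _ tauS tau_w).
have {}xi_x z : partial_x 1 xi z = partial_x 0 tau 0 by rewrite xi_x tau_t.
(* The constants are read off at the origin, and [Omega] is the restriction of zeta to the
   [w]-axis. *)
exists (partial_x 0 tau 0), (eta 0), (tau 0), (xi 0), (theta 0),
  (fun w : R => zeta (w *: basis_u 2%:R)); split.
  apply: (smooth_comp_linear (l := fun w : R => w *: basis_u 2%:R)) => //.
    by move=> a x y; rewrite scalerDl scalerA.
  exact: scalel_continuous.
apply/funext => z; rewrite /canonical_field /mk_field [LHS]surjective_pairing.
congr pair; apply/rowP.
- elim/ord2_ind; rewrite !mxE /=.
  + rewrite [LHS](affine_of_partials tauS tau_t tau_x tau_u tau_v z) w_indep//.
    by rewrite !mulr0 !addr0 addrC mulrC.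
  + rewrite [LHS](affine_of_partials xiS xi_t xi_x xi_u xi_v z) w_indep//.
    by rewrite !mulr0 !addr0 -addrA addrC ![z.1 _ _ * _]mulrC.
- elim/ord3_ind; rewrite !mxE /=; [exact: etaE|exact: thetaE|].
  rewrite [LHS](affine_of_partials zetaS (fun z => (zeta_tx z).1)
    (fun z => (zeta_tx z).2) zeta_u zeta_v z).
  by rewrite !mulr0 !addr0.
Qed.

(** * The converse: the general element is smooth and solves the determining equations *)

Lemma canonical_field_comp d g q p h Omega :
  let Q := canonical_field d g q p h Omega in
  [/\ comp_x Q 0 = (fun z => d * coord_t z + q),
      comp_x Q 1 = (fun z => d * coord_x z + g * coord_t z + p),
      comp_u Q 0 = cst g, comp_u Q 1 = cst h & comp_u Q 2%:R = Omega \o @coord_w R].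
Proof. by split; apply/funext => z; rewrite [LHS]mxE. Qed.

Lemma canonical_field_determining d g q p h Omega z :
  determining_equations (canonical_field d g q p h Omega) z.
Proof.
have [E1 E2 E3 E4 E5] := canonical_field_comp d g q p h Omega.
have D f v c : (forall r : R, f (r *: v + z) = f z + r * c) -> 'D_v f z = c :> R.
  move=> fc; have fv : is_derive z v f c by exact: is_derive_quotient.
  by rewrite derive_val.
have Dx i f c : (forall r, f (r *: basis_x i + z) = f z + r * c) -> partial_x i f z = c.
  exact: D.
have Du a f c : (forall r, f (r *: basis_u a + z) = f z + r * c) -> partial_u a f z = c.
  exact: D.
have D0 (c : R) v : 'D_v (cst c) z = 0 by rewrite derive_cst.
have tau_t : partial_x 0 (fun z => d * coord_t z + q) z = d.
  by apply: Dx => r; rewrite /coord_t /= !mxE /=; ring.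
rewrite /determining_equations E1 E2 E3 E4 E5 tau_t.
have c0 (c : R) i : partial_x i (cst c) z = 0 by exact: D0.
have c1 (c : R) a : partial_u a (cst c) z = 0 by exact: D0.
rewrite !c0 !c1 !mulr0 !addr0.
split=> //.
- by split; [apply: Dx|apply: Du..] => r; rewrite /coord_t /= !mxE /=; ring.
- by split; [apply: Dx|apply: Dx|apply: Du..] => r; rewrite /coord_x /coord_t /= !mxE /=; ring.
- have w0 : partial_x 0 (Omega \o @coord_w R) z = 0.
    by apply: Dx => r; rewrite /coord_w /= !mxE /= !mulr0 add0r addr0.
  have w1 : partial_x 1 (Omega \o @coord_w R) z = 0.
    by apply: Dx => r; rewrite /coord_w /= !mxE /= !mulr0 add0r addr0.
  split; first by rewrite w0 w1 mulr0 addr0.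
  + by apply: Du => r; rewrite /coord_w /= !mxE /= !mulr0 add0r addr0.
  + by apply: Du => r; rewrite /coord_w /= !mxE /= !mulr0 add0r addr0.
Qed.

Lemma jet0_x_linear i : linear (fun z : J0 => z.1 0 i).
Proof. by move=> a x y; rewrite /= !mxE. Qed.

Lemma jet0_u_linear a : linear (fun z : J0 => z.2 0 a).
Proof. by move=> c x y; rewrite /= !mxE. Qed.

Lemma jet0_x_continuous i : continuous (fun z : J0 => z.1 0 i).
Proof.
move=> z; apply: (@continuous_comp _ _ _ fst (fun M : 'rV[R]_2 => M 0 i)).
  exact: cvg_fst.
exact: coord_continuous.
Qed.

Lemma jet0_u_continuous a : continuous (fun z : J0 => z.2 0 a).
Proof.
move=> z; apply: (@continuous_comp _ _ _ snd (fun M : 'rV[R]_3 => M 0 a)).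
  exact: cvg_snd.
exact: coord_continuous.
Qed.

Lemma canonical_field_smooth d g q p h Omega :
  smooth Omega -> smooth_vector_field (canonical_field d g q p h Omega).
Proof.
move=> OS; have [E1 E2 E3 E4 E5] := canonical_field_comp d g q p h Omega.
have tS : smooth (@coord_t R) by exact: smooth_linear (jet0_x_linear 0) (@jet0_x_continuous 0).
have xS : smooth (@coord_x R) by exact: smooth_linear (jet0_x_linear 1) (@jet0_x_continuous 1).
split.
- elim/ord2_ind.
  + rewrite -[X in smooth X]/(comp_x _ 0) E1.
    exact: (smoothD (f := d *: @coord_t R) (smoothZ d tS) (@smooth_cst _ _ _ q)).
  + rewrite -[X in smooth X]/(comp_x _ 1) E2.
    exact: (smoothD (f := d *: @coord_x R + g *: @coord_t R)
      (smoothD (smoothZ d xS) (smoothZ g tS)) (@smooth_cst _ _ _ p)).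
- elim/ord3_ind.
  + by rewrite -[X in smooth X]/(comp_u _ 0) E3; exact: smooth_cst.
  + by rewrite -[X in smooth X]/(comp_u _ 1) E4; exact: smooth_cst.
  + rewrite -[X in smooth X]/(comp_u _ 2%:R) E5.
    exact: smooth_comp_linear (jet0_u_linear _) (@jet0_u_continuous _) OS.
Qed.

Lemma Lie_algebraP (Q : vector_field R 2 3) :
  max_Lie_invariance_algebra (@system_S R) Q <->
  exists d g q p h Omega, smooth Omega /\ Q = canonical_field d g q p h Omega.
Proof.
split=> [[QS /invariance_iff_determining_equations det] |].
  exact: solve_determining_equations.
move=> [d [g [q [p [h [ Omega [OS ->]]]]]]]; split.
  exact: canonical_field_smooth.
by apply/invariance_iff_determining_equations => z; exact: canonical_field_determining.
Qed.

(** * Linear structure of the algebra and its generators *)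

Lemma mk_fieldD (tau xi eta theta zeta tau' xi' eta' theta' zeta' : J0 -> R) :
  mk_field tau xi eta theta zeta + mk_field tau' xi' eta' theta' zeta' =
  mk_field (tau + tau') (xi + xi') (eta + eta') (theta + theta') (zeta + zeta').
Proof.
apply/funext => z; congr pair; apply/rowP.
- by elim/ord2_ind; rewrite !mxE.
- by elim/ord3_ind; rewrite !mxE.
Qed.

Lemma mk_fieldZ (c : R) (tau xi eta theta zeta : J0 -> R) :
  c *: mk_field tau xi eta theta zeta =
  mk_field (c *: tau) (c *: xi) (c *: eta) (c *: theta) (c *: zeta).
Proof.
apply/funext => z; congr pair; apply/rowP.
- by elim/ord2_ind; rewrite !mxE.
- by elim/ord3_ind; rewrite !mxE.
Qed.

Lemma canonical_fieldE d g q p h Omega :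
  canonical_field d g q p h Omega =
  d *: @field_D R + g *: @field_G R + q *: @field_Pt R + p *: @field_Px R
  + h *: @field_Pv R + field_W Omega.
Proof.
have f0 z : (0 : J0 -> R) z = 0 by [].
have f1 z : (1 : J0 -> R) z = 1 by [].
have scaleE (a b : R) : a *: b = a * b by [].
rewrite !mk_fieldZ !mk_fieldD; congr mk_field; apply/funext => z;
by rewrite !fctE ?f0 ?f1 !scaleE; ring.
Qed.

Lemma canonical_fieldD d g q p h Omega d' g' q' p' h' Omega' :
  canonical_field d g q p h Omega + canonical_field d' g' q' p' h' Omega' =
  canonical_field (d + d') (g + g') (q + q') (p + p') (h + h') (Omega + Omega').
Proof.
rewrite mk_fieldD; congr mk_field; apply/funext => z; rewrite !fctE; ring.
Qed.

Lemma canonical_fieldZ c d g q p h Omega :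
  c *: canonical_field d g q p h Omega =
  canonical_field (c * d) (c * g) (c * q) (c * p) (c * h) (c *: Omega).
Proof.
rewrite mk_fieldZ; congr mk_field; apply/funext => z; rewrite !fctE ?[_ *: _]mulrDr; ring.
Qed.

Lemma field_W_canonical (Omega : R -> R) : field_W Omega = canonical_field 0 0 0 0 0 Omega.
Proof. by congr mk_field; apply/funext => z; rewrite ?mul0r ?addr0. Qed.

Lemma generators_canonical (Q : vector_field R 2 3) : generators Q ->
  exists d g q p h Omega, smooth Omega /\ Q = canonical_field d g q p h Omega.
Proof.
have S0 : smooth (cst 0 : R -> R) by exact: smooth_cst.
case=> [[[[[]|]|]|]|].
- move=> ->; exists 1, 0, 0, 0, 0, (cst 0); split=> //.
  by congr mk_field; apply/funext => z; rewrite ?mul1r ?mul0r ?addr0.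
- move=> ->; exists 0, 1, 0, 0, 0, (cst 0); split=> //.
  by congr mk_field; apply/funext => z; rewrite ?mul1r ?mul0r ?addr0 ?add0r.
- move=> ->; exists 0, 0, 1, 0, 0, (cst 0); split=> //.
  by congr mk_field; apply/funext => z; rewrite ?mul0r ?add0r.
- move=> ->; exists 0, 0, 0, 1, 0, (cst 0); split=> //.
  by congr mk_field; apply/funext => z; rewrite ?mul0r ?add0r.
- move=> ->; exists 0, 0, 0, 0, 1, (cst 0); split=> //.
  by congr mk_field; apply/funext => z; rewrite ?mul0r ?add0r.
- move=> [ Omega OS <-]; exists 0, 0, 0, 0, 0, Omega; split=> //.
  exact: field_W_canonical.
Qed.

Lemma Lie_algebra_eq_lin_span :
  max_Lie_invariance_algebra (@system_S R) = lin_span (@generators R).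
Proof.
apply/seteqP; split=> [Q /Lie_algebraP[d [g [q [p [h [ Omega [OS ->]]]]]]] | Q].
(* The list of fields has five entries; the sixth generator, [field_W Omega] with coefficient 1, is
   the default value of [nth]. *)
- exists 6%N, (fun i => [:: d; g; q; p; h; 1]`_i),
    (fun i => nth (field_W Omega) [:: @field_D R; @field_G R; @field_Pt R;
      @field_Px R; @field_Pv R] i); split.
    move=> [[|[|[|[|[|[|//]]]]]] i6] /=; last by right; exists Omega.
    + by left; do 4 left.
    + by left; do 3 left; right.
    + by left; do 2 left; right.
    + by left; left; right.
    + by left; right.
  by rewrite !big_ord_recl big_ord0 /= addr0 scale1r !addrA canonical_fieldE.
- move=> [n [c [b [bG ->]]]]; apply/Lie_algebraP.
  (* Canonical fields include 0 and are stable under sums and scalings, which act on the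
     parameters. *)
  elim/big_ind: _ => [|x y [d [g [q [p [h [ Omega [OS ->]]]]]]]
      [d' [g' [q' [p' [h' [ Omega' [OS' ->]]]]]]]|i _].
  + exists 0, 0, 0, 0, 0, (cst 0); split; first exact: smooth_cst.
    rewrite -field_W_canonical; apply/funext => z; congr pair; apply/rowP.
      by elim/ord2_ind; rewrite !mxE.
    by elim/ord3_ind; rewrite !mxE.
  + rewrite canonical_fieldD.
    exists (d + d'), (g + g'), (q + q'), (p + p'), (h + h'), (Omega + Omega').
    by split=> //; exact: smoothD.
  + have [d [g [q [p [h [ Omega [OS ->]]]]]]] := generators_canonical (bG i).
    rewrite canonical_fieldZ.
    exists (c i * d), (c i * g), (c i * q), (c i * p), (c i * h), (c i *: Omega).
    by split=> //; exact: smoothZ.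
Qed.

(** * Infinite dimension *)

Lemma lin_span_range (V : lmodType R) n (b : 'I_n -> V) v :
  lin_span (range b) v -> exists x : 'I_n -> R, v = \sum_(j < n) x j *: b j.
Proof.
move=> [m [c [b' [b'P ->]]]].
have /choice[f fP] : forall i, exists j, b j = b' i.
  by move=> i; have [j _ <-] := b'P i; exists j.
(* Terms assigned to the same index by [f] have their coefficients added up. *)
exists (fun j => \sum_(i < m | f i == j) c i).
rewrite (partition_big f predT)//=; apply: eq_bigr => j _.
by rewrite scaler_suml; apply: eq_bigr => i /eqP <-; rewrite fP.
Qed.

Lemma Lie_algebra_infinite_dimensional :
  infinite_dimensional (max_Lie_invariance_algebra (@system_S R)).
Proof.
move=> [n [b bspan]].
have W (k : 'I_n.+1) : exists x : 'I_n -> R,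
    field_W (horner 'X^k) = \sum_(j < n) x j *: b j :> vector_field R 2 3.
  apply/lin_span_range/bspan/Lie_algebraP; exists 0, 0, 0, 0, 0, (horner 'X^k).
  by split; [exact: smooth_horner|exact: field_W_canonical].
have {W}[x xP] := choice W.
pose a : 'rV[R]_n.+1 := \row_i i%:R.
pose z (i : 'I_n.+1) : J0 := a 0 i *: basis_u 2%:R.
pose X : 'M[R]_(n.+1, n) := \matrix_(k, j) x k j.
pose B : 'M[R]_(n, n.+1) := \matrix_(j, i) (b j (z i)).2 0 2%:R.
have VE : Vandermonde n.+1 a = X *m B.
  apply/matrixP => k i; rewrite !mxE.
  (* Reading off the [w]-component at the node [z i] is additive, so it passes through the expansion
     of [W(w^k)]. *)
  pose ev (Q : vector_field R 2 3) : R := (Q (z i)).2 0 2%:R.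
  have evD : {morph ev : Q Q' / Q + Q'} by move=> Q Q'; rewrite /ev mxE.
  have ev0 : ev 0 = 0 by rewrite /ev mxE.
  transitivity (ev (field_W (horner 'X^k))).
    by rewrite /ev mxE /= /coord_w /= !mxE /= mulr1 hornerXn.
  rewrite xP (big_morph ev evD ev0); apply: eq_bigr => j _.
  by rewrite /ev !mxE.
have : Vandermonde n.+1 a \in unitmx.
  (* The determinant is a product of differences of distinct naturals, nonzero in characteristic
     0. *)
  rewrite unitmxE unitfE det_Vandermonde; apply/prodf_neq0 => i _.
  apply/prodf_neq0 => j ij; rewrite !mxE subr_eq0 eqr_nat.
  by rewrite neq_ltn ij orbT.
rewrite -row_free_unit /row_free VE => /eqP r.
(* [X] has only [n] columns, whereas invertibility gives rank [n.+1]. *)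
have := leq_trans (mxrankM_maxl X B) (rank_leq_col X).
by rewrite r ltnn.
Qed.


End Solution.

Theorem theorem1 (R : realType) :
  infinite_dimensional (max_Lie_invariance_algebra (@system_S R)) /\
  max_Lie_invariance_algebra (@system_S R) = lin_span (@generators R).
Proof.
by split; [exact: Lie_algebra_infinite_dimensional|exact: Lie_algebra_eq_lin_span].
Qed.
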